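(* Let $\bar{x}$ be a strictly feasible point of the problem $\max\{\phi(x) : Ax=b,\ x\in X\}$, i.e. $\bar{x}\in\mathrm{int}(X)\cap\{x : Ax=b\}$. Then, for any $t>0$ and any $y\in\mathbb{R}^m$, $$g(y)-\phi(\bar{x})\ge 0\quad\text{and}\quad g(y;t)-\phi(\bar{x})+tF(\bar{x})\ge 0.$$ Moreover, $$g(y;t)\le g(y)\le g(y;t)+t(\nu+F(\bar{x}))+2\sqrt{t\nu}\,\big[g(y;t)+tF(\bar{x})-\phi(\bar{x})\big]^{1/2}.$$
   Context: Problem data: $m,N\ge 1$; for $i=1,\dots,N$, $\phi_i:\mathbb{R}^{n_i}\to\mathbb{R}$ is concave, $X_i\subset\mathbb{R}^{n_i}$ is a nonempty closed convex set, $A_i\in\mathbb{R}^{m\times n_i}$, $b_i\in\mathbb{R}^m$; $n=\sum_i n_i$, $A=[A_1,\dots,A_N]$, $b=\sum_i b_i$, $X=X_1\times\cdots\times X_N$, $\phi(x)=\sum_i\phi_i(x_i)$. The separable convex problem is $\phi^*=\max\{\phi(x): Ax=b,\ x\in X\}$. Standing assumptions. (A1) The solution set of this problem is nonempty; either $X$ is polyhedral or $\mathrm{ri}(X)\cap\{x: Ax=b\}\ne\emptyset$; the $\phi_i$ are proper, upper semicontinuous and concave; $A$ has full row rank. (A2) Each $X_i$ is bounded and is endowed with a self-concordant barrier $F_i$ (defined on $\mathrm{int}(X_i)\neq\emptyset$) with parameter $\nu_i>0$. Notation: $x_i^c=\arg\min_{\mathrm{int}(X_i)}F_i$ is the analytic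 center, and $F_i$ is normalized so that $F_i(x_i^c)=0$. $F(x)=\sum_iF_i(x_i)$, a self-concordant barrier of $X$ with parameter $\nu=\sum_i\nu_i$. The dual function is $g(y)=\max_{x\in X}\{\phi(x)+y^T(Ax-b)\}$ and, for $t>0$, the smoothed dual function is $g(y;t)=\max_{x\in\mathrm{int}(X)}\{\phi(x)+y^T(Ax-b)-tF(x)\}$. *)

(* Defs.v *)
From HB Require Import structures.
From mathcomp Require Import all_boot all_order all_algebra.
From mathcomp Require Import all_classical all_reals all_analysis.
Set Implicit Arguments.
Unset Strict Implicit.
Unset Printing Implicit Defensive.
Import Order.TTheory GRing.Theory Num.Theory.
Import numFieldNormedType.Exports.
Local Open Scope classical_set_scope.
Local Open Scope ring_scope.

Section MaxArgmin.
Context {R : realType}.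

(* The greatest element of S; the default value 0 is only used when S has no
   greatest element, so that max_value is a maximum and not a supremum. *)
Definition max_value (S : set R) : R := xget 0 (S `&` ubound S).

Definition is_argmin T (S : set T) (f : T -> R) (x : T) :=
  S x /\ forall z, S z -> f x <= f z.

Definition is_argmax T (S : set T) (f : T -> R) (x : T) :=
  S x /\ forall z, S z -> f z <= f x.

End MaxArgmin.

Section Convexity.
Context {R : realType} {n : nat}.
Implicit Types (S : set 'cV[R]_n) (f : 'cV[R]_n -> R).

Definition concave_function S f := convex_function S (fun x => - f x).

Definition upper_semicontinuous f :=
  lower_semicontinuous (fun x => (- f x)%:E).

Definition polyhedral S := exists (k : nat) (C : 'M[R]_(k, n)) (d : 'cV[R]_k),
  S = [set x | forall j, (C *m x) j 0 <= d j 0].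

Definition affine_set S :=
  forall (x y : 'cV[R]_n) (s : R), S x -> S y -> S (s *: x + (1 - s) *: y).

Definition affine_hull S : set 'cV[R]_n := smallest affine_set S.

Definition relint S : set 'cV[R]_n :=
  [set x | S x /\ \forall u \near x, affine_hull S u -> S u].

End Convexity.

Section SelfConcordance.
Context {R : realType} {n : nat}.

(* f is C^k on the open set U: all iterated directional derivatives of f up to
   order k exist and are continuous on U. *)
Fixpoint C_on (k : nat) (U : set 'cV[R]_n) (f : 'cV[R]_n -> R) : Prop :=
  (forall x, U x -> {for x, continuous f}) /\
  match k with
  | 0 => True
  | k'.+1 => forall v : 'cV[R]_n,
      (forall x, U x -> derivable f x v) /\ C_on k' U ('D_v f)
  end.

(* F is a (standard) self-concordant barrier of X with parameter nu. Only the
   values of F on X° are constrained; 'D_h ('D_h F) x is the second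
   differential D^2F(x)[h,h], and similarly for the third one. *)
Record self_concordant_barrier (X : set 'cV[R]_n) (nu : R)
    (F : 'cV[R]_n -> R) : Prop := SelfConcordantBarrier {
  scb_smooth : C_on 3 X° F ;
  scb_convex : convex_function X° F ;
  scb_boundary : forall z, closure X° z -> ~ X° z ->
    F x @[x --> within X° (nbhs z)] --> +oo%R ;
  scb_third : forall x h, X° x ->
    `|'D_h ('D_h ('D_h F)) x| <= 2 * ('D_h ('D_h F) x) `^ (3 / 2) ;
  scb_param : forall x h, X° x -> ('D_h F x) ^+ 2 <= nu * 'D_h ('D_h F) x
}.

End SelfConcordance.

Section Separable.
Context {R : realType} {N : nat} {n_ : 'I_N -> nat}.

(* A vector x of R^n, n = \sum_i n_i, has the blocks x_i = submxcol x i. *)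
Definition separable_sum (f_ : forall i, 'cV[R]_(n_ i) -> R) :
  'cV[R]_(\sum_i n_ i) -> R := fun x => \sum_i f_ i (submxcol x i).

Definition block_prod (X_ : forall i, set 'cV[R]_(n_ i)) :
  set 'cV[R]_(\sum_i n_ i) := [set x | forall i, X_ i (submxcol x i)].

End Separable.

Section Dual.
Context {R : realType} {m n : nat}.
Variables (phi : 'cV[R]_n -> R) (A : 'M[R]_(m, n)) (b : 'cV[R]_m).
Variable X : set 'cV[R]_n.

Definition affine_constraint : set 'cV[R]_n := [set x | A *m x = b].

Definition lagrangian (x : 'cV[R]_n) (y : 'cV[R]_m) : R :=
  phi x + (y^T *m (A *m x - b)) 0 0.

Definition dual_fun (y : 'cV[R]_m) : R :=
  max_value [set lagrangian x y | x in X].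

Definition smoothed_dual_fun (F : 'cV[R]_n -> R) (y : 'cV[R]_m) (t : R) : R :=
  max_value [set lagrangian x y - t * F x | x in X°].

End Dual.

(* Main.v *)
(** Restricted to a segment, a barrier satisfies [psi' ^ 2 <= nu psi''], so that
    [1 / psi'] decreases at rate at least [1 / nu] wherever [psi' > 0]; as [psi']
    stays finite on the half-open unit interval, this forces
    [psi' s <= nu / (1 - s)].  Hence [F] increases by at most
    [nu * tau / (1 - tau)] between [xbar] and [xbar + tau (xs - xbar)], where
    [xs] maximizes the Lagrangian [L] over [X].
    Testing the maximality of the smoothed dual function at that point, and
    using the concavity of [L] and [L xbar = phi xbar], gives with
    [s = tau / (1 - tau)] and [D = g(y; t) + t F(xbar) - phi(xbar)]
      [g(y) - phi(xbar) <= D + t nu + D / s + t nu s]  for all [s > 0];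
    it remains to minimize over [s]. *)
Require Import Defs.
From HB Require Import structures.
From mathcomp Require Import all_boot all_order all_algebra.
From mathcomp Require Import all_classical all_reals all_analysis.
From mathcomp Require Import ring lra.
Import Order.TTheory GRing.Theory Num.Theory.
Import numFieldNormedType.Exports.
Local Open Scope classical_set_scope.
Local Open Scope ring_scope.
Set Implicit Arguments.
Unset Strict Implicit.
Unset Printing Implicit Defensive.

(** * Maxima and upper semicontinuity *)

Lemma max_valueE (R : realType) (S : set R) (v : R) :
  S v -> ubound S v -> max_value S = v.
Proof.
move=> Sv ubv; rewrite /max_value; case: xgetP => [w _ [Sw ubw]|/(_ v) []//].
by apply/eqP; rewrite eq_le ubv// ubw.
Qed.

(** Stated at a single point and for real values, so that interior points and the other points of
    the space can be treated by different arguments. *)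
Definition usc_at (R : realType) (T : topologicalType) (f : T -> R) (x : T) :=
  forall a, f x < a -> \forall z \near x, f z < a.

Lemma usc_atD (R : realType) (T : topologicalType) (f g : T -> R) (x : T) :
  usc_at f x -> usc_at g x -> usc_at (fun z => f z + g z) x.
Proof.
move=> fx gx a fga.
have /fx fn : f x < f x + (a - (f x + g x)) / 2 by lra.
have /gx gn : g x < g x + (a - (f x + g x)) / 2 by lra.
by apply: filterS2 fn gn => z; lra.
Qed.

Lemma continuous_usc_at (R : realType) (T : topologicalType) (f : T -> R)
  (x : T) : {for x, continuous f} -> usc_at f x.
Proof. by move=> fx a; exact: cvgr_lt. Qed.

Lemma usc_at_comp (R : realType) (S T : topologicalType) (g : S -> T)
  (f : T -> R) (x : S) :
  {for x, continuous g} -> usc_at f (g x) -> usc_at (f \o g) x.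
Proof. by move=> gx fgx a /fgx /gx. Qed.

Lemma usc_at_sum (R : realType) (T : topologicalType) (I : finType)
  (f : I -> T -> R) (x : T) :
  (forall i, usc_at (f i) x) -> usc_at (fun z => \sum_i f i z) x.
Proof.
move=> fx; elim: (index_enum I) => [|i s IH] a.
  by rewrite big_nil => a0; near=> z; rewrite big_nil.
rewrite big_cons => /(usc_atD (fx i) IH) H.
by near=> z; rewrite big_cons; near: z.
Unshelve. all: by end_near. Qed.

Lemma upper_semicontinuousP (R : realType) n (f : 'cV[R]_n -> R) :
  upper_semicontinuous f <-> forall x, usc_at f x.
Proof.
split=> [fusc x a fxa|fusc x a].
  have [|V Vx Vlt] := fusc x (- a); first by rewrite lte_fin ltrN2.
  by apply: filterS Vx => z /Vlt; rewrite lte_fin ltrN2.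
rewrite lte_fin ltrNr => /fusc fx; eexists; first exact: fx.
by move=> z /=; rewrite lte_fin ltrNr.
Qed.

(** The open conditions [f z < i] cover [K] as [i] tends to infinity, so compactness bounds [f]. If
    the supremum were not attained, they would already cover [K] as [i] tends to it from the left,
    and some [i] below the supremum would be an upper bound. *)
Lemma compact_usc_argmax (R : realType) (T : topologicalType) (K : set T)
  (f : T -> R) : K !=set0 -> compact K -> (forall x, K x -> usc_at f x) ->
  exists x, is_argmax K f x.
Proof.
move=> [x0 Kx0] /compact_near_coveringP cK fusc.
have [M fM] : exists M, forall x, K x -> f x < M.
  have /cK : forall x, K x ->
      \forall z \near x & i \near +oo, f z < i.
    move=> x /fusc /(_ (f x + 1)); rewrite ltrDl => /(_ ltr01) fx1.
    exists ([set z | f z < f x + 1], [set i | f x + 1 < i]) => /=.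
      by split; [exact: fx1|apply: nbhs_pinfty_gt; rewrite num_real].
    by move=> [z i] [/=]; exact: lt_trans.
  by move=> /filter_ex[M fM]; exists M.
have supf : has_sup (f @` K).
  by split; [exists (f x0), x0|exists M => _ [z /fM/ltW ? <-]].
have [[x Kx fx]|nomax] := pselect (exists2 x, K x & f x = sup (f @` K)).
  exists x; split=> // z Kz; rewrite fx; apply: ub_le_sup; first by case: supf.
  by exists z.
have fs x : K x -> f x < sup (f @` K).
  move=> Kx; rewrite lt_neqAle; apply/andP; split.
    by apply/eqP => fx; apply: nomax; exists x.
  by apply: ub_le_sup; [case: supf|exists x].
have /cK : forall x, K x ->
    \forall z \near x & i \near (sup (f @` K))^'-, f z < i.
  move=> x Kx; have [a] := midf_lt (fs x Kx); set c := (_ / 2) => cs.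
  exists ([set z | f z < c], [set i | c < i]) => /=.
    by split; [exact: fusc|exact: nbhs_left_gt].
  by move=> [z i] [/=]; exact: lt_trans.
move=> H; have /filter_ex[i [fi]] :
    \forall i \near (sup (f @` K))^'-, (K `<=` fun z => f z < i) /\ i < sup (f @` K).
  by apply: filterI; [exact: H|exact: nbhs_left_lt].
rewrite ltNge => /negP[]; apply: ge_sup; first by exists (f x0), x0.
by move=> _ [z /fi/ltW ? <-].
Qed.

(** * Continuity and compactness in matrix spaces *)

Lemma mx_entrywise_continuous (R : realType) (T : topologicalType) m n
  (f : T -> 'M[R]_(m, n)) (x : T) :
  (forall i j, {for x, continuous (fun z => f z i j)}) ->
  {for x, continuous f}.
Proof.
move=> fx; apply/cvg_ballP => e e0.
have : \forall z \near x, forall i j, ball (f x i j) e (f z i j).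
  apply: filter_forall => i; apply: filter_forall => j.
  by move/cvg_ballP : (fx i j); apply.
by apply: filterS.
Qed.

Lemma mxsub_continuous (R : realType) m n p q (h : 'I_p -> 'I_m)
  (k : 'I_q -> 'I_n) :
  continuous (fun A : 'M[R]_(m, n) => \matrix_(i, j) A (h i) (k j)).
Proof.
move=> A; apply: mx_entrywise_continuous => i j.
rewrite (_ : (fun _ => _) = fun A : 'M[R]_(m, n) => A (h i) (k j)).
  exact: coord_continuous.
by apply/funext => B; rewrite mxE.
Qed.

Lemma submxcol_continuous (R : realType) N (n_ : 'I_N -> nat) i :
  continuous (fun x : 'cV[R]_(\sum_i n_ i) => submxcol x i).
Proof. exact: mxsub_continuous. Qed.

Lemma mx_norm_trmx (R : realType) m n (A : 'M[R]_(m, n)) : `|A^T| = `|A|.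
Proof.
suff le_trmx p q (B : 'M[R]_(p, q)) : `|B^T| <= `|B|.
  by apply/eqP; rewrite eq_le le_trmx -{1}[A]trmxK le_trmx.
rewrite [leLHS]/Num.norm/= mx_normrE; apply: bigmax_le => // -[i j] _ /=.
rewrite mxE [leRHS]/Num.norm/= mx_normrE.
by apply: (@le_bigmax _ _ _ 0 (fun ij => `|B ij.1 ij.2|) (j, i)).
Qed.

(** Transposition is continuous and preserves the norm, so the Heine-Borel theorem carries over from
    row vectors. *)
Lemma cV_bounded_closed_compact (R : realType) n (A : set 'cV[R]_n) :
  bounded_set A -> closed A -> compact A.
Proof.
move=> [M [Mr bA]] cA.
have trmx_cont p q : continuous (@trmx R p q).
  move=> B; apply: mx_entrywise_continuous => i j.
  rewrite (_ : (fun _ => _) = fun A : 'M[R]_(p, q) => A j i).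
    exact: coord_continuous.
  by apply/funext => C; rewrite mxE.
rewrite (_ : A = trmx @` (trmx @^-1` A)); last first.
  apply/seteqP; split=> [v Av|_ [v Av <-]//].
  by exists v^T; rewrite /= trmxK.
apply: continuous_compact; first exact/continuous_subspaceT/trmx_cont.
apply: bounded_closed_compact; last first.
  by apply: preimage_closed => // ? _; exact: trmx_cont.
exists M; split=> // B MB v /= Av; rewrite -mx_norm_trmx; exact: (bA _ MB).
Qed.

(** * Convexity along segments *)

Lemma convex_set_segment (R : realType) (E : lmodType R) (X : set E) (x z : E)
  (s : R) : convex_set X -> X x -> X z -> 0 <= s -> s <= 1 ->
  X (s *: z + (1 - s) *: x).
Proof.
move=> cX Xx Xz s0 s1; have := cX z x (Itv01 s0 s1).
by rewrite !inE; apply.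
Qed.

Lemma concave_function_segment (R : realType) n (f : 'cV[R]_n -> R)
  (x z : 'cV[R]_n) (s : R) : concave_function setT f -> 0 <= s -> s <= 1 ->
  s * f z + (1 - s) * f x <= f (s *: z + (1 - s) *: x).
Proof.
move=> cf s0 s1; have := cf (Itv01 s0 s1) z x.
rewrite !inE => /(_ I I); rewrite convRE /= /unstable.onem.
by rewrite !mulrN -opprD lerN2.
Qed.

Lemma convex_interior_segment (R : realType) (E : normedModType R) (X : set E)
  (x z : E) (s : R) : convex_set X -> X° x -> X z -> 0 <= s -> s < 1 ->
  X° (x + s *: (z - x)).
Proof.
move=> cX Xx Xz s0 s1.
have s1' : 1 - s != 0 by rewrite subr_eq0 gt_eqF.
(* [p] inverts the contraction [u |-> s *: z + (1 - s) *: u]. A point [w] near the target is thus a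
   combination of [z] and of [p w], which is near [x] and so in [X]. *)
pose p w := (1 - s)^-1 *: (w - s *: z).
have pc : {for x + s *: (z - x), continuous p}.
  apply: cvgZ; first exact: cvg_cst.
  by apply: cvgB; [exact: cvg_id|exact: cvg_cst].
have px : p (x + s *: (z - x)) = x.
  rewrite /p [s *: (z - x)]scalerBr addrA addrAC addrK -{1}[x]scale1r -scalerBl scalerA.
  by rewrite mulVf// scale1r.
have /pc pX : nbhs (p (x + s *: (z - x))) X by rewrite px.
suff: \forall w \near x + s *: (z - x), X w by [].
near=> w; have Xpw : X (p w) by near: w; exact: pX.
rewrite (_ : w = s *: z + (1 - s) *: p w); last first.
  by rewrite scalerA divff// scale1r addrC subrK.
by apply: convex_set_segment => //; exact: ltW.
Unshelve. all: by end_near. Qed.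

(** * Growth of a barrier along a segment *)

(** Both difference quotients are the same function, so derivability in the direction [h] is
    enough. *)
Lemma is_derive_line (R : realType) (V W : normedModType R) (f : V -> W)
  (x h : V) (s : R) : derivable f (x + s *: h) h ->
  is_derive s 1 (fun r => f (x + r *: h)) ('D_h f (x + s *: h)).
Proof.
have E : (fun r : R => r^-1 *: (((fun r => f (x + r *: h)) \o shift s) (r *: 1) -
    f (x + s *: h))) = (fun r => r^-1 *: ((f \o shift (x + s *: h)) (r *: h) -
    f (x + s *: h))).
  apply/funext => r /=; congr (_ *: (f _ - _)).
  by rewrite [r *: 1]mulr1 scalerDl addrCA.
by move=> fd; apply: DeriveDef; rewrite /derivable/derive E.
Qed.

Lemma barrier_derivative_bound (R : realType) (d1 d2 : R -> R) (nu : R) :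
  0 < nu ->
  (forall s : R, 0 <= s -> s < 1 -> is_derive s 1 d1 (d2 s)) ->
  (forall s : R, 0 <= s -> s < 1 -> d1 s ^+ 2 <= nu * d2 s) ->
  forall s : R, 0 <= s -> s < 1 -> d1 s <= nu / (1 - s).
Proof.
move=> nu0 dd1 d12 s s0 s1; rewrite leNgt; apply/negP => ds.
have s1' : 0 < 1 - s by rewrite subr_gt0.
have ds0 : 0 < d1 s by rewrite (lt_trans _ ds)// divr_gt0.
have d2_ge0 r : 0 <= r -> r < 1 -> 0 <= d2 r.
  move=> r0 r1; rewrite -(pmulr_rge0 _ nu0).
  by apply: le_trans (d12 _ r0 r1); exact: sqr_ge0.
(* [r] is where the line of slope [- 1 / nu] through [(s, 1 / d1 s)] reaches zero; the negated bound
   says exactly that [r < 1]. *)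
pose r := s + nu / d1 s.
have sr : s < r by rewrite ltrDl divr_gt0.
have r1 : r < 1.
  rewrite /r -ltrBrDl ltr_pdivrMr//.
  by move: ds; rewrite ltr_pdivrMr// mulrC.
have in01 u : s <= u -> u <= r -> 0 <= u /\ u < 1.
  by move=> su ur; split; [exact: le_trans su|exact: le_lt_trans r1].
(* [d1] is nondecreasing because [d2] is nonnegative, so it stays positive and can be inverted on
   the whole interval. *)
have d1_gt0 u : s <= u -> u <= r -> 0 < d1 u.
  rewrite le_eqVlt => /predU1P[<-//|su] ur.
  have [v||v vsu E] := @MVT R d1 d2 s u su.
  - rewrite in_itv/= => /andP[/ltW sv /ltW vu].
    by have [] := in01 v sv (le_trans vu ur); exact: dd1.
  - apply: derivable_within_continuous => v.
    rewrite in_itv/= => /andP[sv vu].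
    by have [v0 v1] := in01 v sv (le_trans vu ur); have [] := dd1 v v0 v1.
  - move: vsu; rewrite in_itv/= => /andP[/ltW sv /ltW vu].
    have [v0 v1] := in01 v sv (le_trans vu ur).
    apply: (lt_le_trans ds0); rewrite -subr_ge0 E mulr_ge0 ?d2_ge0//.
    by rewrite subr_ge0 ltW.
(* The slope of [1 / d1] is at most [- 1 / nu], so [1 / d1] would vanish by [r]. *)
pose q u := (d1 u)^-1.
have dq u : s <= u -> u <= r -> is_derive u 1 q (- (d1 u) ^- 2 * d2 u).
  move=> su ur; have [u0 u1] := in01 u su ur.
  have := dd1 u u0 u1 => du.
  by apply: is_deriveV; rewrite gt_eqF// d1_gt0.
have [u||u usr E] := @MVT R q (fun u => - (d1 u) ^- 2 * d2 u) s r sr.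
- rewrite in_itv/= => /andP[/ltW su /ltW ur]; exact: dq.
- apply: derivable_within_continuous => u.
  by rewrite in_itv/= => /andP[su ur]; have [] := dq u su ur.
- move: usr; rewrite in_itv/= => /andP[/ltW su /ltW ur].
  have [u0 u1] := in01 u su ur; have du := d1_gt0 u su ur.
  have : 0 < q r by rewrite invr_gt0 d1_gt0// ltW.
  apply/negP; rewrite -leNgt.
  have -> : q r = q s - d2 u / d1 u ^+ 2 * (nu / d1 s).
    by rewrite -[LHS](subrK (q s)) E /r; ring.
  rewrite subr_le0 /q mulrA ler_peMl ?invr_ge0 ?(ltW ds0)//.
  by rewrite mulrAC ler_pdivlMr ?exprn_gt0// mul1r mulrC d12.
Qed.

(** By the mean value theorem the increment is [s * d1 u] with [u < s], and
    [d1 u <= nu / (1 - u) <= nu / (1 - s)]. Integrating would give a sharper logarithmic bound, but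
    this one leads directly to the square root in the final estimate. *)
Lemma barrier_line_bound (R : realType) n (X : set 'cV[R]_n) (nu : R)
  (F : 'cV[R]_n -> R) (x z : 'cV[R]_n) (s : R) :
  convex_set X -> 0 < nu -> self_concordant_barrier X nu F ->
  X° x -> X z -> 0 < s -> s < 1 ->
  F (x + s *: (z - x)) <= F x + nu * (s / (1 - s)).
Proof.
move=> cX nu0 [/= [_ FD] _ _ _ Fnu] Xx Xz s0 s1.
set h := z - x.
have Xline (r : R) : 0 <= r -> r < 1 -> X° (x + r *: h).
  exact: convex_interior_segment.
pose d1 r := 'D_h F (x + r *: h).
pose d2 r := 'D_h ('D_h F) (x + r *: h).
have [FD1 [_ /(_ h)[FD2 _]]] := FD h.
have dF (r : R) : 0 <= r -> r < 1 -> is_derive r 1 (fun r : R => F (x + r *: h)) (d1 r).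
  by move=> r0 r1; apply: is_derive_line; apply: FD1; exact: Xline.
have dd1 (r : R) : 0 <= r -> r < 1 -> is_derive r 1 d1 (d2 r).
  by move=> r0 r1; apply: is_derive_line; apply: FD2; exact: Xline.
have d1_le := barrier_derivative_bound nu0 dd1 (fun r r0 r1 => Fnu _ h (Xline r r0 r1)).
have [u||u] := @MVT R (fun r : R => F (x + r *: h)) d1 0 s s0.
- rewrite in_itv/= => /andP[/ltW u0 us]; apply: dF => //; exact: lt_trans s1.
- apply: derivable_within_continuous => u.
  rewrite in_itv/= => /andP[u0 us].
  by have [] := dF u u0 (le_lt_trans us s1).
rewrite in_itv/= => /andP[/ltW u0 us]; rewrite scale0r addr0 subr0.
move=> E; rewrite -lerBlDl E mulrCA mulrC ler_wpM2l ?(ltW s0)//.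
apply: le_trans (d1_le u u0 (lt_trans us s1)) _.
rewrite ler_wpM2l ?(ltW nu0)// lef_pV2 ?posrE ?subr_gt0 ?(lt_trans us)//; lra.
Qed.

(** For [a > 0] the right-hand side is minimal at [s = sqrt a / sqrt c]. For [a = 0] its infimum is
    not attained, hence the case split. *)
Lemma le_two_sqrt_mul (R : realType) (G a c : R) : 0 <= a -> 0 < c ->
  (forall s, 0 < s -> G <= a / s + c * s) ->
  G <= 2 * Num.sqrt c * Num.sqrt a.
Proof.
move=> a0 c0 Gs; have sc0 : 0 < Num.sqrt c by rewrite sqrtr_gt0.
have sqrE (u : R) : 0 <= u -> u = Num.sqrt u * Num.sqrt u.
  by move=> u0; rewrite -expr2 sqr_sqrtr.
move: a0; rewrite le_eqVlt => /predU1P[a0|a0].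
  rewrite -a0 sqrtr0 mulr0 leNgt; apply/negP => G0.
  (* At this [s], with [a = 0], the hypothesis reads [G <= G / 2]. *)
  have := Gs (G / (2 * c)); rewrite -a0 mul0r add0r divr_gt0 ?mulr_gt0//.
  move=> /(_ isT); rewrite leNgt => /negP; apply.
  rewrite (_ : c * _ = G / 2); first lra.
  by field; rewrite gt_eqF.
have sa0 : 0 < Num.sqrt a by rewrite sqrtr_gt0.
apply: le_trans (Gs (Num.sqrt a / Num.sqrt c) _) _; first by rewrite divr_gt0.
rewrite [X in X / _](sqrE a) ?(ltW a0)// [X in _ + X * _](sqrE c) ?(ltW c0)//.
rewrite le_eqVlt; apply/orP; left; apply/eqP; field.
by rewrite !gt_eqF.
Qed.

(** * Linear maps and block vectors *)

Lemma mulmx_continuous (R : realType) m n p (A : 'M[R]_(m, n)) :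
  continuous (fun B : 'M[R]_(n, p) => A *m B).
Proof.
move=> B; apply: mx_entrywise_continuous => i j.
have sum_cont : continuous (fun B : 'M[R]_(n, p) => \sum_k A i k * B k j).
  apply: continuous_big => [|k _ C]; first exact: add_continuous.
  by apply: continuousM; [exact: cst_continuous|exact: coord_continuous].
rewrite (_ : (fun _ => _) = fun B : 'M[R]_(n, p) => \sum_k A i k * B k j).
  exact: sum_cont.
by apply/funext => C; rewrite mxE.
Qed.

Lemma submxcolZ (R : pzRingType) N (n_ : 'I_N -> nat) m (c : R)
  (x : 'M[R]_(\sum_i n_ i, m)) i : submxcol (c *: x) i = c *: submxcol x i.
Proof. by apply/matrixP => k l; rewrite !mxE. Qed.

Lemma block_prod_interior (R : realType) N (n_ : 'I_N -> nat)
  (X_ : forall i, set 'cV[R]_(n_ i)) :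
  (block_prod X_)° = block_prod (fun i => (X_ i)°).
Proof.
apply/seteqP; split=> [x Xx i|x Xx].
(* [p] replaces the block [i] of [x] by [v]; it is continuous, so it pulls a neighborhood of [x]
   inside the product back to a neighborhood of the block inside [X_ i]. *)
- pose p (v : 'cV[R]_(n_ i)) : 'cV[R]_(\sum_i n_ i) :=
    \mxcol_j dfwith (submxcol x) i v j.
  have pc : {for submxcol x i, continuous p}.
    apply: mx_entrywise_continuous => k l.
    rewrite (_ : (fun _ => _) = fun v => dfwith (submxcol x) i v (tagnat.sig1 k)
      (tagnat.sig2 k) l); last by apply/funext => v; rewrite mxE.
    have [E|E] := eqVneq i (tagnat.sig1 k).
      move: (tagnat.sig2 k); rewrite -E => k2.
      rewrite (_ : (fun _ => _) = fun v : 'cV[R]_(n_ i) => v k2 l).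
        exact: coord_continuous.
      by apply/funext => v; rewrite dfwithin.
    rewrite (_ : (fun _ => _) = fun=> submxcol x _ (tagnat.sig2 k) l).
      exact: cst_continuous.
    by apply/funext => v; rewrite dfwithout.
  have px : p (submxcol x i) = x.
    rewrite /p -[RHS]submxcolK; apply: eq_mxcol => j; by case: dfwithP.
  have /pc pX : nbhs (p (submxcol x i)) (block_prod X_) by rewrite px.
  suff: \forall v \near submxcol x i, X_ i v by [].
  near=> v; have : block_prod X_ (p v) by near: v; exact: pX.
  by move=> /(_ i); rewrite /p mxcolK dfwithin.
- have Xz i : \forall z \near x, X_ i (submxcol z i).
    exact: (submxcol_continuous (Xx i)).
  exact: (@filter_forall _ _ _ _ (nbhs_filter x) Xz).
Unshelve. all: by end_near. Qed.

Unset Implicit Arguments.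

(** * The Lagrangian and the barrier of the separable problem *)

Section SeparableDual.
Context {R : realType} {m N : nat} {n_ : 'I_N -> nat}.
Variables (phi_ : forall i, 'cV[R]_(n_ i) -> R)
  (X_ : forall i, set 'cV[R]_(n_ i))
  (A : 'M[R]_(m, \sum_i n_ i)) (b : 'cV[R]_m)
  (F_ : forall i, 'cV[R]_(n_ i) -> R) (nu_ : 'I_N -> R)
  (y : 'cV[R]_m).
Let X := block_prod X_.
Let phi := separable_sum phi_.
Let F := separable_sum F_.
Let nu := \sum_i nu_ i.
Let L x := lagrangian phi A b x y.

Lemma lagrangian_usc_at (x : 'cV[R]_(\sum_i n_ i)) :
  (forall i, upper_semicontinuous (phi_ i)) -> usc_at L x.
Proof.
move=> phi_usc; apply: usc_atD.
  apply: usc_at_sum => i; apply: (@usc_at_comp _ _ _ _ (phi_ i)).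
    exact: submxcol_continuous.
  by move/upper_semicontinuousP : (phi_usc i); apply.
apply: continuous_usc_at => /=.
apply: (continuous_comp (f := fun z => y^T *m (A *m z - b))
  (g := fun M : 'M[R]_1 => M 0 0)); last exact: coord_continuous.
apply: (continuous_comp (f := fun z => A *m z - b) (g := mulmx y^T)).
  by apply: continuousB; [exact: mulmx_continuous|exact: cst_continuous].
exact: mulmx_continuous.
Qed.

(** The constraint term is affine in [x] and contributes an equality; concavity comes from each
    [phi_ i]. *)
Lemma lagrangian_concave (x z : 'cV[R]_(\sum_i n_ i)) (s : R) :
  (forall i, concave_function setT (phi_ i)) -> 0 <= s -> s <= 1 ->
  s * L z + (1 - s) * L x <= L (s *: z + (1 - s) *: x).
Proof.
move=> cphi s0 s1; rewrite /L /lagrangian.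
have -> : A *m (s *: z + (1 - s) *: x) - b =
    s *: (A *m z - b) + (1 - s) *: (A *m x - b).
  rewrite mulmxDr -!scalemxAr !scalerBr addrACA -opprD -scalerDl.
  by rewrite [s + _]addrC subrK scale1r.
rewrite [y^T *m (s *: _ + _)]mulmxDr -!scalemxAr.
set u := y^T *m (A *m z - b); set v := y^T *m (A *m x - b).
have -> : (s *: u + (1 - s) *: v) 0 0 = s * u 0 0 + (1 - s) * v 0 0.
  by rewrite !mxE.
rewrite !mulrDr addrACA lerD2r.
rewrite /phi /separable_sum !mulr_sumr -big_split/=; apply: ler_sum => i _.
rewrite submxcolD !submxcolZ.
exact: concave_function_segment.
Qed.

Lemma block_prod_compact : (forall i, closed (X_ i)) ->
  (forall i, bounded_set (X_ i)) -> compact X.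
Proof.
move=> clX bX; apply: cV_bounded_closed_compact.
- have XM i : \forall M \near (+oo : set_system R), forall v, X_ i v -> `|v| <= M.
    exact: bX.
  have {}XM := filter_forall _ XM.
  suff : \forall M \near (+oo : set_system R), forall x, X x -> `|x| <= M by [].
  near=> M => x Xx /=.
  (* The norm is a maximum of entries started at 0, so the bound must also dominate 0. *)
  have M0 : 0 <= M by near: M; apply: nbhs_pinfty_ge; rewrite num_real.
  have Mx i : `|submxcol x i| <= M.
    by move: i (submxcol x i) (Xx i); near: M; exact: XM.
  rewrite [leLHS]/Num.norm/= mx_normrE; apply: bigmax_le => // -[k l] _ /=.
  apply: le_trans (Mx (tagnat.sig1 k)).
  rewrite [leRHS]/Num.norm/= mx_normrE.
  have -> : x k l = submxcol x (tagnat.sig1 k) (tagnat.sig2 k) l.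
    by rewrite -[in LHS](submxcolK x) mxE.
  by apply: (@le_bigmax _ _ _ 0
    (fun ij => `|submxcol x (tagnat.sig1 k) ij.1 ij.2|) (tagnat.sig2 k, l)).
- have -> : X = \bigcap_i ((fun x => submxcol x i) @^-1` X_ i).
    by apply/seteqP; split=> [x Xx i _|x Xx i]; exact: Xx.
  apply: closed_bigI => i _; apply: preimage_closed => // ? _.
  exact: submxcol_continuous.
Unshelve. all: by end_near. Qed.

Hypothesis X_closed : forall i, closed (X_ i).
Hypothesis X_bounded : forall i, bounded_set (X_ i).
Hypothesis X_convex : forall i, convex_set (X_ i).
Hypothesis phi_usc : forall i, upper_semicontinuous (phi_ i).
Hypothesis phi_concave : forall i, concave_function setT (phi_ i).
Hypothesis nu_gt0 : forall i, 0 < nu_ i.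
Hypothesis F_barrier : forall i, self_concordant_barrier (X_ i) (nu_ i) (F_ i).
Hypothesis F_ge0 : forall i x, (X_ i)° x -> 0 <= F_ i x.

Lemma separable_barrier_ge0 x : X° x -> 0 <= F x.
Proof. by rewrite block_prod_interior => Xx; apply: sumr_ge0 => i _; exact: F_ge0. Qed.

(** The one-block estimates are summed: all blocks share the same [s], so the parameters add up to
    [nu]. *)
Lemma separable_barrier_segment (x z : 'cV[R]_(\sum_i n_ i)) (s : R) :
  X° x -> X z -> 0 < s -> s < 1 ->
  X° (x + s *: (z - x)) /\
  F (x + s *: (z - x)) <= F x + nu * (s / (1 - s)).
Proof.
rewrite block_prod_interior => Xx Xz s0 s1.
have E i : submxcol (x + s *: (z - x)) i =
    submxcol x i + s *: (submxcol z i - submxcol x i).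
  by rewrite submxcolD submxcolZ submxcolB.
split=> [i|].
  by rewrite E; exact: (convex_interior_segment (X_convex i) (Xx i) (Xz i) (ltW s0)).

rewrite /F /nu /separable_sum mulr_suml -big_split/=; apply: ler_sum => i _.
by rewrite E; exact: (barrier_line_bound (X_convex i) (nu_gt0 i) (F_barrier i)).
Qed.

(** Some block of [z] lies outside the interior of its [X_ i]. If it is in the closure of that
    interior, [F_ i] blows up there; otherwise no interior point is nearby. The other blocks only
    add nonnegative terms. *)
Lemma separable_barrier_boundary (z : 'cV[R]_(\sum_i n_ i)) (K : R) :
  ~ X° z -> \forall x \near z, X° x -> K < F x.
Proof.
rewrite block_prod_interior => /existsNP[i Xzi].
have : \forall v \near submxcol z i, (X_ i)° v -> K < F_ i v.
  have [cl|ncl] := pselect (closure (X_ i)° (submxcol z i)).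
    have /cvgryPgt/(_ K) := scb_boundary (F_barrier i) cl Xzi.
    by rewrite near_withinE.
  move/existsNP : ncl => [V /not_implyP[Vz]] /set0P/negP/negPn/eqP XV.
  by apply: filterS Vz => v Vv Xv; have : set0 v by rewrite -XV.
move=> /submxcol_continuous KF; near=> x => Xx.
have : (X_ i)° (submxcol x i) -> K < F_ i (submxcol x i) by near: x; exact: KF.
move=> /(_ (Xx i)) /lt_le_trans; apply.
rewrite /F /separable_sum (bigD1 i)//= lerDl; apply: sumr_ge0 => j _.
exact: F_ge0.
Unshelve. all: by end_near. Qed.

(** * Attainment of the smoothed maximum and the gap estimate *)

Lemma smoothed_argmax_exists (t : R) : 0 < t -> X° !=set0 ->
  exists x, is_argmax X° (fun x => L x - t * F x) x.
Proof.
move=> t0 [x0 Xx0]; pose c := L x0 - t * F x0.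
(* Since [F] blows up at the boundary, the objective extended by [c - 1] outside
   of [X°] is upper semicontinuous everywhere, and it is maximal inside [X°]. *)
pose G x := if `[< X° x >] then L x - t * F x else c - 1.
have Gusc z : usc_at G z.
  have [Xz|nXz] := pselect (X° z); last first.
    move=> a; rewrite {1}/G asboolF// => ca.
    have /(lagrangian_usc_at z phi_usc) Lz : L z < L z + 1 by lra.
    (* The threshold solves [L z + 1 - t * K = c - 1], so the objective falls below [c - 1] near
       [z]. *)
    have Fz := separable_barrier_boundary z ((L z + 1 - c + 1) / t) nXz.
    near=> x; rewrite /G; case: asboolP => // Xx.
    have Lx : L x < L z + 1 by near: x.
    have : (L z + 1 - c + 1) / t < F x by move: Xx; near: x.
    by rewrite ltr_pdivrMr// mulrC; lra.
  have FE x : L x - t * F x = L x + \sum_i - t * F_ i (submxcol x i).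
    by rewrite -mulNr mulr_sumr.
  have : usc_at (fun x => L x - t * F x) z.
    under [X in usc_at X]eq_fun do rewrite FE.
    apply: usc_atD; first exact: lagrangian_usc_at.
    apply: usc_at_sum => i.
    apply: (@usc_at_comp _ _ _ _ (fun v => - t * F_ i v)).
      exact: submxcol_continuous.
    apply: continuous_usc_at; apply: continuousM; first exact: cst_continuous.
    have [+ _] := scb_smooth (F_barrier i); apply.
    by move: Xz; rewrite block_prod_interior; apply.
  move=> Hz a; rewrite {1}/G asboolT// => /Hz Ha.
  have Xn : \forall x \near z, X° x by exact: nbhs_interior.
  by apply: filterS2 Ha Xn => x ? ?; rewrite /G asboolT.
have [|x [Xx Gmax]] := compact_usc_argmax _ (block_prod_compact X_closed X_bounded)
  (fun x _ => Gusc x); first by exists x0; exact: interior_subset.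
(* Outside the interior [G] equals [c - 1], less than its value [c] at [x0]. *)
have Xx' : X° x.
  apply: contrapT => nXx.
  have := Gmax _ (interior_subset Xx0).
  by rewrite /G asboolT// asboolF// -/c; lra.
exists x; split=> // z Xz.
by have := Gmax z (interior_subset Xz); rewrite /G !asboolT.
Unshelve. all: by end_near. Qed.

(** [D] measures how far the feasible point [x] is from optimal for the smoothed problem; it is
    compared with a point moved from [x] towards [xs]. *)
Lemma dual_gap (x xs xt : 'cV[R]_(\sum_i n_ i)) (t : R) : 0 < t ->
  (0 < N)%N -> X° x -> A *m x = b -> is_argmax X L xs ->
  is_argmax X° (fun x => L x - t * F x) xt ->
  let D := L xt - t * F xt + t * F x - phi x in
  0 <= D /\ L xs - phi x <= D + t * nu + 2 * Num.sqrt (t * nu) * Num.sqrt D.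
Proof.
move=> t0 N0 Xx Axb [Xxs _] [Xxt xtmax] D.
have Lx : L x = phi x.
  by rewrite /L /lagrangian Axb subrr mulmx0 mxE addr0.
have D0 : 0 <= D by have := xtmax x Xx; rewrite Lx /D; lra.
split=> //.
have nu0 : 0 < nu.
  rewrite /nu (bigD1 (Ordinal N0))//= ltr_pwDl//.
  by apply: sumr_ge0 => i _; exact: ltW.
(* What remains on the left is to be bounded by [D / s + t * nu * s] for every [s > 0]. *)
suff : L xs - phi x - D - t * nu <= 2 * Num.sqrt (t * nu) * Num.sqrt D by lra.
apply: le_two_sqrt_mul; rewrite ?mulr_gt0// => s s0.
(* with [tau = s / (1 + s)] one has [tau / (1 - tau) = s] *)
pose tau := s / (1 + s).
have s1 : 1 + s != 0 by lra.
have tau0 : 0 < tau by rewrite divr_gt0//; lra.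
have tau1 : tau < 1 by rewrite ltr_pdivrMr; lra.
have tauE : tau / (1 - tau) = s by rewrite /tau; field; apply/andP; split=> //; lra.
have [Xz Fz] := separable_barrier_segment _ _ _ Xx Xxs tau0 tau1.
have := xtmax _ Xz; rewrite tauE in Fz.
have := @lagrangian_concave x xs tau phi_concave (ltW tau0) (ltW tau1).
rewrite (_ : tau *: xs + (1 - tau) *: x = x + tau *: (xs - x)); last first.
  by rewrite scalerBl scale1r scalerBr addrCA.
set z := x + _ in Fz *; rewrite Lx => Lz Gz.
have tFz : t * F z <= t * (F x + nu * s) by rewrite ler_pM2l.
(* Concavity bounds the left side by [L z - phi x]; maximality of [xt] and the barrier growth bound
   that by the right side. *)
have : tau * (L xs - phi x) <= D + t * nu * s by rewrite /D; lra.
rewrite mulrC -ler_pdivlMr// => H.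
(* Since [1 / tau = 1 + 1 / s], the division by [tau] yields the four terms [D], [D / s], [t * nu]
   and [t * nu * s]. *)
rewrite (_ : D / s + _ = (D + t * nu * s) / tau - D - t * nu) ?lerD2r//.
by rewrite /tau; field; rewrite s1 gt_eqF.
Qed.

End SeparableDual.

Theorem lemma1 (R : realType) (m N : nat) (n_ : 'I_N -> nat)
    (phi_ : forall i, 'cV[R]_(n_ i) -> R)
    (X_ : forall i, set 'cV[R]_(n_ i))
    (A_ : forall i, 'M[R]_(m, n_ i)) (b_ : 'I_N -> 'cV[R]_m)
    (F_ : forall i, 'cV[R]_(n_ i) -> R) (nu_ : 'I_N -> R)
    (xc_ : forall i, 'cV[R]_(n_ i))
    (A := \mxrow_i A_ i) (b := \sum_i b_ i)
    (X := block_prod X_) (phi := separable_sum phi_)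
    (F := separable_sum F_) (nu := \sum_i nu_ i)
    (m_gt0 : (0 < m)%N) (N_gt0 : (0 < N)%N)
    (phi_concave : forall i, concave_function [set: 'cV[R]_(n_ i)] (phi_ i))
    (X_nonempty : forall i, X_ i !=set0)
    (X_closed : forall i, closed (X_ i))
    (X_convex : forall i, convex_set (X_ i))
    (solution_exists :
      exists xs, is_argmax (X `&` affine_constraint A b) phi xs)
    (qualification :
      polyhedral X \/ relint X `&` affine_constraint A b !=set0)
    (phi_usc : forall i, upper_semicontinuous (phi_ i))
    (A_full_row_rank : row_free A)
    (X_bounded : forall i, bounded_set (X_ i))
    (X_interior : forall i, (X_ i)° !=set0)
    (nu_gt0 : forall i, 0 < nu_ i)
    (F_barrier : forall i, self_concordant_barrier (X_ i) (nu_ i) (F_ i))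
    (xc_center : forall i, is_argmin (X_ i)° (F_ i) (xc_ i))
    (F_normalized : forall i, F_ i (xc_ i) = 0)
    (xbar : 'cV[R]_(\sum_i n_ i))
    (xbar_strictly_feasible : (X° `&` affine_constraint A b) xbar)
    (t : R) (t_gt0 : 0 < t) (y : 'cV[R]_m)
    (g := dual_fun phi A b X) (gs := smoothed_dual_fun phi A b X F) :
  [/\ 0 <= g y - phi xbar,
      0 <= gs y t - phi xbar + t * F xbar,
      gs y t <= g y &
      g y <= gs y t + t * (nu + F xbar)
             + 2 * Num.sqrt (t * nu)
                 * Num.sqrt (gs y t + t * F xbar - phi xbar)].
Proof.
have [Xx Axb] := xbar_strictly_feasible.
(* The normalization makes 0 the minimum of each barrier. *)
have F_ge0 i x : (X_ i)° x -> 0 <= F_ i x.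
  by move=> Xix; rewrite -(F_normalized i); exact: (xc_center i).2.
pose L x := lagrangian phi A b x y.
have [|xs xsmax] := @compact_usc_argmax R _ X L _
    (block_prod_compact X_ X_closed X_bounded)
    (fun x _ => lagrangian_usc_at phi_ A b y x phi_usc).
  by exists xbar; exact: interior_subset.
have [|xt xtmax] := smoothed_argmax_exists phi_ X_ A b F_ nu_ y X_closed
    X_bounded phi_usc F_barrier F_ge0 t t_gt0.
  by exists xbar.
(* Both maxima are attained, so [max_value] returns them and not its default. *)
have gE : g y = L xs.
  apply: max_valueE; first by exists xs => //; exact: xsmax.1.
  by move=> _ [z Xz <-]; exact: xsmax.2.
have gsE : gs y t = L xt - t * F xt.
  apply: max_valueE; first by exists xt => //; exact: xtmax.1.
  by move=> _ [z Xz <-]; exact: xtmax.2.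
have [D0 gap] := dual_gap phi_ X_ A b F_ nu_ y X_convex phi_concave nu_gt0
  F_barrier xbar xs xt t t_gt0 N_gt0 Xx Axb xsmax xtmax.
have Lxbar : L xbar = phi xbar.
  by rewrite /L /lagrangian Axb subrr mulmx0 mxE addr0.
have DE : gs y t + t * F xbar - phi xbar =
    L xt - t * F xt + t * F xbar - phi xbar by rewrite gsE.
split.
- by rewrite gE subr_ge0 -Lxbar; exact: xsmax.2 (interior_subset Xx).
- by rewrite addrAC DE.
- rewrite gsE gE; apply: le_trans (xsmax.2 _ (interior_subset xtmax.1)).
  rewrite gerBl; apply: mulr_ge0; first exact: ltW.
  exact: (separable_barrier_ge0 X_ F_ F_ge0 xt xtmax.1).
(* Adding [phi xbar] to [D] leaves [gs y t + t * F xbar]. The square-root term is named so that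
   [lra] sees it as an atom. *)
- rewrite DE gE; move: gap; rewrite -/phi -/F -/nu -/(L xs) -/(L xt) gsE.
  set S := 2 * _ * _; lra.
Qed.
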